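(* Let $X=(X^1,\dots,X^m)\in C^\infty(U,\mathbb{R}^m)$ be an isometric embedding of a (pseudo-)Riemannian metric $g[0]$ on a coordinate chart $U$ into $\mathbb{R}^{p,m-p}$, and let $g$ be the noncommutative metric $$g_{ij}=g(E_i,\tilde E_j)=\sum_{\alpha=1}^m\eta_{\alpha\alpha}\,\partial_iX^\alpha*\partial_jX^\alpha .$$ Let $R_{ij},\Theta_{ij}$ and $R^i_j,\Theta^i_j$ be the Ricci curvatures of the canonical connection induced by $X$. Then for all $q\in\mathbb{N}_0$ and all $i,j$, $$R_{ij}[2q]=\Theta_{ji}[2q],\quad R_{ij}[2q+1]=-\Theta_{ji}[2q+1],\quad R^i_j[2q]=\Theta^i_j[2q],\quad R^i_j[2q+1]=-\Theta^i_j[2q+1].$$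
   Context: Indices $i,j,k,l,\dots$ range over $1,\dots,n$, with the Einstein summation convention. $U$ is a coordinate chart of an $n$-dimensional manifold with coordinates $(x^1,\dots,x^n)$, $\partial_i=\partial/\partial x^i$. $\mathcal{A}_U=C^\infty(U)[[\hbar]]$ with real smooth coefficients; for $h\in\mathcal{A}_U$, $h[q]$ is the coefficient of $\hbar^q$. Fix a constant real skew-symmetric $n\times n$ matrix $(\theta^{ij})$. The Moyal product is $(u*v)(x)=\big[\exp(\hbar\theta^{ij}\partial_i\partial'_j)u(x)v(x')\big]_{x=x'}$ for $u,v\in C^\infty(U)$, extended $\mathbb{R}[[\hbar]]$-bilinearly to $\mathcal{A}_U$ (formal series in $\hbar$ being multiplied degree by degree); it is associative and $\partial_i$ satisfies the Leibniz rule for it. Isometric embedding: $\eta=\mathrm{diag}(-1,\dots,-1,1,\dots,1)$ ($p$ entries $-1$, $m-p$ entries $1$) is the flat metric of $\mathbb{R}^{p,m-p}$, and $X$ isometric means $g_{ij}[0]=\sum_\alpha\eta_{\alpha\alpha}\,\partial_iX^\alpha\cdot\partial_jX^\alpha$ (pointwise product), where $(g_{ij}[0])$ is a (pseudo-)Riemannian metric, i.e. symmetric and invertible at each point. $\mathcal{T}_U$ (resp. $\tilde{\mathcal{T}}_U$) is the free left (resp. right) $(\mathcal{A}_U,* )$-module with basis $E_i=\partial_i$ (resp. $\tilde E_i=\partial_i$); $g:\mathcal{T}_U\otimes_{\mathbb{R}[[\hbar]]}\tilde{\mathcal{T}}_U\to\mathcal{A}_U$ is the two-sided module homomorphism with $g(a*E_i,\tilde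 E_j*b)=a*g_{ij}*b$; $(g^{ij})$ is the matrix over $\mathcal{A}_U$ with $g_{ik}*g^{kj}=g^{jk}*g_{ki}=\delta_i^j$. The canonical connection induced by $X$ is the pair $(\nabla,\tilde\nabla)$ of $\mathbb{R}[[\hbar]]$-linear covariant derivatives $\nabla_i$ on $\mathcal{T}_U$ and $\tilde\nabla_i$ on $\tilde{\mathcal{T}}_U$ with $\nabla_i(f*V)=(\partial_if)*V+f*\nabla_iV$, $\tilde\nabla_i(\tilde V*f)=\tilde V*(\partial_if)+\tilde\nabla_i\tilde V*f$, and $\nabla_iE_j=\Gamma_{ij}^k*E_k$, $\tilde\nabla_i\tilde E_j=\tilde E_k*\tilde\Gamma_{ij}^k$, where $\Gamma_{ij}^l*g_{lk}=\Gamma_{ijk}=\sum_\alpha\eta_{\alpha\alpha}\,\partial_i\partial_jX^\alpha*\partial_kX^\alpha$ and $g_{kl}*\tilde\Gamma_{ij}^l=\tilde\Gamma_{ijk}=\sum_\alpha\eta_{\alpha\alpha}\,\partial_kX^\alpha*\partial_i\partial_jX^\alpha$. (Its chiral coefficients are $\Upsilon_{ijk}=\Gamma_{ijk}-\tilde\Gamma_{ijk}$.) Curvatures: $\mathcal{R}_{E_iE_j}=\nabla_i\nabla_j-\nabla_j\nabla_i$, $R_{lkij}=g(\mathcal{R}_{E_iE_j}E_k,\tilde E_l)$, $R_{kj}=R_{lkij}*g^{li}$, $\Theta_{il}=g^{jk}*R_{lkij}$, $R^p_j=g^{pk}*R_{lkij}*g^{li}$, $\Theta^p_i=g^{jk}*R_{lkij}*g^{lp}$.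 *)

(* Defs.v *)
(* MathComp and MathComp-Analysis throughout. *)
From HB Require Import structures.
From mathcomp Require Import all_boot all_order all_algebra.
From mathcomp Require Import all_classical all_reals all_analysis.
Set Implicit Arguments.
Unset Strict Implicit.
Unset Printing Implicit Defensive.
Import Order.TTheory GRing.Theory Num.Theory.
Import numFieldNormedType.Exports.
Local Open Scope classical_set_scope.
Local Open Scope ring_scope.

(* A coordinate chart is represented by its coordinate domain, an open subset
   of R^n. *)
Record chart (R : realType) (n : nat) := Chart {
  chart_set :> set 'rV[R]_n;
  chart_open : open chart_set }.

Section Smooth.
Context {R : realType} {n : nat}.
Implicit Types (U : set 'rV[R]_n) (f g : 'rV[R]_n -> R).

Definition partial (i : 'I_n) f : 'rV[R]_n -> R :=
  fun x => 'D_(delta_mx 0 i) f x.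

Fixpoint class_C U (k : nat) f : Prop :=
  (forall x, U x -> {for x, continuous f}) /\
  (if k is k'.+1 then
     forall i, (forall x, U x -> derivable f x (delta_mx 0 i)) /\
               class_C U k' (partial i f)
   else True).

Definition smooth_on U f := forall k, class_C U k f.

Lemma class_CS U k f : class_C U k.+1 f -> class_C U k f.
Proof.
elim: k f => [|k IHk] f [fc fd]; first by split.
by split=> // i; have [fi /IHk] := fd i.
Qed.

Lemma class_C_eq U k f g : open U -> (forall x, U x -> f x = g x) ->
  class_C U k f -> class_C U k g.
Proof.
move=> oU; elim: k f g => [|k IHk] f g fg [fc fd];
  have near_fg x : U x -> \forall y \near x, f y = g y.
- by move=> Ux; near=> y; apply: fg; near: y; exact: open_nbhs_nbhs.
- split=> // x Ux; rewrite /prop_for /continuous_at -(fg _ Ux).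
  exact: cvg_trans (near_eq_cvg (near_fg x Ux)) (fc x Ux).
- by move=> Ux; near=> y; apply: fg; near: y; exact: open_nbhs_nbhs.
split=> [x Ux|i].
  rewrite /prop_for /continuous_at -(fg _ Ux).
  exact: cvg_trans (near_eq_cvg (near_fg x Ux)) (fc x Ux).
have [dfi cfi] := fd i; split=> [x Ux|].
  exact: near_eq_derivable (near_fg x Ux) (dfi x Ux).
apply: IHk cfi => x Ux; exact: near_eq_derive (near_fg x Ux).
Unshelve. all: by end_near.
Qed.

Lemma class_C_cst U k (c : R) : class_C U k (cst c).
Proof.
elim: k c => [|k IHk] c; split=> //; try by move=> x _; exact: cst_continuous.
move=> i; split=> [x _|]; first exact: derivable_cst.
suff -> : partial i (cst c) = cst 0 by [].
by apply/funext => x; rewrite /partial derive_cst.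
Qed.

Lemma class_CD U k f g : open U ->
  class_C U k f -> class_C U k g -> class_C U k (f + g).
Proof.
move=> oU; elim: k f g => [|k IHk] f g [fc fd] [gc gd]; split=> //;
  try by move=> x Ux; apply: continuousD; [exact: fc|exact: gc].
move=> i; have [dfi cfi] := fd i; have [dgi cgi] := gd i.
split=> [x Ux|]; first by apply: derivableD; [exact: dfi|exact: dgi].
apply: class_C_eq (IHk _ _ cfi cgi) => // x Ux.
by rewrite /partial deriveD//; [exact: dfi|exact: dgi].
Qed.

Lemma class_CZ U k (c : R) f : open U ->
  class_C U k f -> class_C U k (c *: f).
Proof.
move=> oU; elim: k f => [|k IHk] f [fc fd]; split=> //;
  try by move=> x Ux; apply: continuousZl_tmp; exact: fc.
move=> i; have [dfi cfi] := fd i.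
split=> [x Ux|]; first by apply: derivableZ; exact: dfi.
apply: class_C_eq (IHk _ cfi) => // x Ux.
by rewrite /partial deriveZ//; exact: dfi.
Qed.

Lemma class_CM U k f g : open U ->
  class_C U k f -> class_C U k g -> class_C U k (f * g).
Proof.
move=> oU; elim: k f g => [|k IHk] f g Cf Cg.
  case: Cf Cg => fc _ [gc _]; split=> // x Ux.
  by apply: continuousM; [exact: fc|exact: gc].
have [[fc fd] [gc gd]] := (Cf, Cg).
split=> [x Ux|i]; first by apply: continuousM; [exact: fc|exact: gc].
have [dfi cfi] := fd i; have [dgi cgi] := gd i.
split=> [x Ux|]; first by apply: derivableM; [exact: dfi|exact: dgi].
apply: (@class_C_eq _ _ (f * partial i g + g * partial i f)) => //.
  by move=> x Ux; rewrite /partial deriveM//; [exact: dfi|exact: dgi].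
by apply: class_CD => //; apply: IHk => //; exact: class_CS.
Qed.

Definition cinf_pred U : {pred 'rV[R]_n -> R} :=
  fun f => `[< smooth_on U f /\ forall x, ~ U x -> f x = 0 >].

End Smooth.

(* C^oo(U): a smooth function on U is represented by its extension by 0 to
   R^n, so that two smooth functions agree on U iff they are equal. No
   regularity is asked at the boundary of U. *)
Record cinf (R : realType) (n : nat) (U : chart R n) := Cinf {
  cinf_fun :> 'rV[R]_n -> R;
  cinfP : cinf_fun \in cinf_pred U }.

Section CinfAlgebra.
Context {R : realType} {n : nat} (U : chart R n).

HB.instance Definition _ := [isSub for @cinf_fun R n U].
HB.instance Definition _ := [Choice of cinf U by <:].

Lemma cinf_submod_closed : submod_closed (@cinf_pred R n U).
Proof.
split=> [|c f g /asboolP[sf f0] /asboolP[sg g0]]; apply/asboolP; split=> //.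
- by move=> k; exact: (class_C_cst U k 0).
- move=> k; apply: class_CD (sg k); first exact: chart_open.
  by apply: class_CZ (sf k); exact: chart_open.
- move=> x Ux; suff -> : (c *: f + g) x = c * f x + g x.
    by rewrite f0// g0// mulr0 addr0.
  by [].
Qed.

HB.instance Definition _ :=
  GRing.isSubmodClosed.Build R ('rV[R]_n -> R) (@cinf_pred R n U)
    cinf_submod_closed.
HB.instance Definition _ := [SubChoice_isSubLmodule of cinf U by <:].

Lemma cinf_ext (f g : cinf U) : (forall x, chart_set U x -> f x = g x) -> f = g.
Proof.
move=> fg; apply: val_inj; apply/funext => x /=.
have [Ux|nUx] := pselect (chart_set U x); first exact: fg.
have /asboolP[_ f0] := cinfP f; have /asboolP[_ g0] := cinfP g.
by rewrite f0// g0.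
Qed.

Lemma cinf_oneP : (fun x => (x \in chart_set U)%:R) \in cinf_pred U.
Proof.
apply/asboolP; split=> [k|x nUx]; last by rewrite memNset.
apply: class_C_eq (class_C_cst U _ 1); first exact: chart_open.
by move=> x Ux; rewrite mem_set.
Qed.

Lemma cinf_mulP (f g : cinf U) : (f : _ -> R) * (g : _ -> R) \in cinf_pred U.
Proof.
have /asboolP[sf f0] := cinfP f; have /asboolP[sg g0] := cinfP g.
apply/asboolP; split=> [k|x nUx].
  by apply: class_CM (sf k) (sg k); exact: chart_open.
suff -> : ((f : _ -> R) * (g : _ -> R)) x = f x * g x by rewrite f0// mul0r.
by [].
Qed.

Definition cinf_one : cinf U := Cinf cinf_oneP.
Definition cinf_mul (f g : cinf U) : cinf U := Cinf (cinf_mulP f g).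

Fact cinf_mulA : associative cinf_mul.
Proof. by move=> f g h; apply: val_inj; rewrite /= mulrA. Qed.
Fact cinf_mulC : commutative cinf_mul.
Proof. by move=> f g; apply: val_inj; rewrite /= mulrC. Qed.
Fact cinf_mul1 : left_id cinf_one cinf_mul.
Proof.
move=> f; apply: cinf_ext => x Ux /=.
by rewrite [LHS](_ : _ = (x \in chart_set U)%:R * f x)// mem_set// mul1r.
Qed.
Fact cinf_mulDl : left_distributive cinf_mul +%R.
Proof. by move=> f g h; apply: val_inj; rewrite /= mulrDl. Qed.

HB.instance Definition _ := GRing.Zmodule_isComPzRing.Build (cinf U)
  cinf_mulA cinf_mulC cinf_mul1 cinf_mulDl.

Lemma pdP (i : 'I_n) (f : cinf U) : partial i f \_ U \in cinf_pred U.
Proof.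
have /asboolP[sf f0] := cinfP f; apply/asboolP; split=> [k|x nUx].
  have [_ /(_ i)[_]] := sf k.+1.
  apply: class_C_eq; first exact: chart_open.
  by move=> x Ux; rewrite patchE mem_set.
by rewrite patchE memNset.
Qed.

Definition pd (i : 'I_n) (f : cinf U) : cinf U := Cinf (pdP i f).

End CinfAlgebra.

(* A_U = C^oo(U)[[hbar]]; the coefficient h[q] is the application h q. *)
Definition fseries (R : realType) (n : nat) (U : chart R n) := nat -> cinf U.

HB.instance Definition _ (R : realType) (n : nat) (U : chart R n) :=
  GRing.Lmodule.copy (fseries U) (nat -> cinf U).

Section Moyal.
Context {R : realType} {n : nat} (U : chart R n) (theta : 'M[R]_n).
Implicit Types (u v : cinf U) (a b : fseries U).

Definition hconst u : fseries U := fun q => if q == 0%N then u else 0.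

Definition hpd (i : 'I_n) a : fseries U := fun q => pd i (a q).

(* The scalar action of R[[hbar]]. *)
Definition hscale (c : nat -> R) a : fseries U :=
  fun q => \sum_(k < q.+1) c k *: a (q - k)%N.

(* [ (theta^{ij} d_i d'_j)^q u(x) v(x') ] at x = x'. *)
Fixpoint bidiff (q : nat) u v : cinf U :=
  if q is q'.+1 then
    \sum_i \sum_j theta i j *: bidiff q' (pd i u) (pd j v)
  else u * v.

Definition moyal (q : nat) u v : cinf U := (q`!%:R)^-1 *: bidiff q u v.

Definition star a b : fseries U :=
  fun q => \sum_(k < q.+1) \sum_(l < (q - k).+1)
             moyal (q - k - l)%N (a k) (b l).

End Moyal.

Section Geometry.
Context {R : realType} {n m : nat} (U : chart R n) (theta : 'M[R]_n).
Local Notation A := (fseries U).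
Local Notation "a ** b" := (star theta a b)
  (at level 40, left associativity).

Definition pseudo_riemannian (g0 : 'I_n -> 'I_n -> cinf U) : Prop :=
  (forall i j, g0 i j = g0 j i) /\
  (forall x, chart_set U x -> (\matrix_(i, j) g0 i j x) \in unitmx).

(* The alpha-th diagonal entry of eta; the index alpha counts from 0. *)
Definition eta (p : nat) (al : 'I_m) : R := if (al < p)%N then -1 else 1.

Definition emb_map (X : 'I_m -> cinf U) (x : 'rV[R]_n) : 'rV[R]_m :=
  \row_al X al x.

(* Injective immersion which is a homeomorphism onto its image. *)
Definition smooth_embedding (X : 'I_m -> cinf U) : Prop :=
  [/\ forall x, chart_set U x -> row_free (\matrix_(i, al) pd i (X al) x),
      set_inj U (emb_map X) &
      forall V, open V -> V `<=` U ->
        exists2 W, open W & V = U `&` emb_map X @^-1` W].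

Definition isometric p (X : 'I_m -> cinf U) (g0 : 'I_n -> 'I_n -> cinf U) :=
  forall i j, g0 i j = \sum_al eta p al *: (pd i (X al) * pd j (X al)).

Definition nc_metric p (X : 'I_m -> cinf U) (i j : 'I_n) : A :=
  \sum_al eta p al *: (hpd i (hconst (X al)) ** hpd j (hconst (X al))).

Definition kdelta (i j : 'I_n) : A := hconst (if i == j then 1 else 0).

Definition inverse_metric (g ginv : 'I_n -> 'I_n -> A) : Prop :=
  forall i j, \sum_k g i k ** ginv k j = kdelta i j /\
              \sum_k ginv j k ** g k i = kdelta i j.

(* The free left and right modules, by coordinates in E_i and in \tilde E_i. *)
Definition ltan := {ffun 'I_n -> A}.
Definition rtan := {ffun 'I_n -> A}.

Definition lact (a : A) (V : ltan) : ltan := [ffun k => a ** V k].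
Definition ract (V : rtan) (a : A) : rtan := [ffun k => V k ** a].
Definition lE (i : 'I_n) : ltan := [ffun k => kdelta i k].
Definition rE (i : 'I_n) : rtan := [ffun k => kdelta i k].
Definition tscale (c : nat -> R) (V : {ffun 'I_n -> A}) : {ffun 'I_n -> A} :=
  [ffun k => hscale c (V k)].

Definition metric_form (g : 'I_n -> 'I_n -> A) (V : ltan) (W : rtan) : A :=
  \sum_i \sum_j V i ** g i j ** W j.

Definition hlinear (D : {ffun 'I_n -> A} -> {ffun 'I_n -> A}) : Prop :=
  forall c V W, D (tscale c V + W) = tscale c (D V) + D W.

Definition left_covariant (nab : 'I_n -> ltan -> ltan) : Prop :=
  forall i, hlinear (nab i) /\
    forall f V, nab i (lact f V) = lact (hpd i f) V + lact f (nab i V).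

Definition right_covariant (nabt : 'I_n -> rtan -> rtan) : Prop :=
  forall i, hlinear (nabt i) /\
    forall V f, nabt i (ract V f) = ract V (hpd i f) + ract (nabt i V) f.

(* Gamma_{ijk} and \tilde Gamma_{ijk}. *)
Definition Gam p (X : 'I_m -> cinf U) (i j k : 'I_n) : A :=
  \sum_al eta p al *:
    (hpd i (hpd j (hconst (X al))) ** hpd k (hconst (X al))).
Definition Gamt p (X : 'I_m -> cinf U) (i j k : 'I_n) : A :=
  \sum_al eta p al *:
    (hpd k (hconst (X al)) ** hpd i (hpd j (hconst (X al)))).

(* In the existentials, G i j k is Gamma_{ij}^k, and likewise for
   \tilde Gamma_{ij}^k. *)
Record canonical_connection p (X : 'I_m -> cinf U)
    (nab : 'I_n -> ltan -> ltan) (nabt : 'I_n -> rtan -> rtan) : Prop := {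
  cc_left : left_covariant nab;
  cc_right : right_covariant nabt;
  cc_Gamma : exists G : 'I_n -> 'I_n -> 'I_n -> A,
    (forall i j, nab i (lE j) = \sum_k lact (G i j k) (lE k)) /\
    (forall i j k, \sum_l G i j l ** nc_metric p X l k = Gam p X i j k);
  cc_Gammat : exists G : 'I_n -> 'I_n -> 'I_n -> A,
    (forall i j, nabt i (rE j) = \sum_k ract (rE k) (G i j k)) /\
    (forall i j k, \sum_l nc_metric p X k l ** G i j l = Gamt p X i j k) }.

Section Curvature.
Variables (g ginv : 'I_n -> 'I_n -> A) (nab : 'I_n -> ltan -> ltan).

Definition curv_op (i j : 'I_n) (V : ltan) : ltan :=
  nab i (nab j V) - nab j (nab i V).

(* R_{lkij} *)
Definition curvature (l k i j : 'I_n) : A :=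
  metric_form g (curv_op i j (lE k)) (rE l).

(* R_{kj} *)
Definition Ricci (k j : 'I_n) : A :=
  \sum_l \sum_i curvature l k i j ** ginv l i.

(* Theta_{il} *)
Definition Theta (i l : 'I_n) : A :=
  \sum_j \sum_k ginv j k ** curvature l k i j.

(* R^p_j *)
Definition Ricci_up (p j : 'I_n) : A :=
  \sum_k \sum_l \sum_i ginv p k ** curvature l k i j ** ginv l i.

(* Theta^p_i *)
Definition Theta_up (p i : 'I_n) : A :=
  \sum_j \sum_k \sum_l ginv j k ** curvature l k i j ** ginv l p.

End Curvature.
End Geometry.

(* Main.v *)
(* Let bar be the R-linear involution hbar |-> - hbar of A_U. As theta is skew,
   bar reverses star products, and bar commutes with the d_i and fixes the X^al.
   Hence bar g_ij = g_ji, so bar g^ij = g^ji, and bar exchanges Gamma_ijk with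
   \tilde Gamma_ijk. Lowering an index in the curvature yields Gauss' equation
     R_lkij = (H_jkil - Gamma_jkr * g^rs * \tilde Gamma_ils) - (i <-> j),
     H_abce = sum_al eta_al d_a d_b X^al * d_c d_e X^al,
   so that bar R_lkij = R_klji. Applying bar to the Ricci curvatures gives
   bar R_ij = Theta_ji and bar R^i_j = Theta^i_j, which is the claim degree by
   degree. *)
Require Import Defs.
From HB Require Import structures.
From mathcomp Require Import all_boot all_order all_algebra.
From mathcomp Require Import all_classical all_reals all_analysis.

Set Implicit Arguments.
Unset Strict Implicit.
Unset Printing Implicit Defensive.
Import Order.TTheory GRing.Theory Num.Theory.
Import numFieldNormedType.Exports.

Local Open Scope classical_set_scope.
Local Open Scope ring_scope.

(** * Symmetry of second derivatives *)

Section Schwarz.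
Context {R : realType} {V : normedModType R}.
Implicit Types (f : V -> R) (x u v : V).

Lemma is_derive_line f x v (s : R) : derivable f (x + s *: v) v ->
  is_derive s 1 (fun t => f (x + t *: v)) ('D_v f (x + s *: v)).
Proof.
rewrite /derivable => df.
have E : (fun h : R => h^-1 *: (((fun t => f (x + t *: v)) \o shift s) (h *: 1)
    - f (x + s *: v))) =
  (fun h => h^-1 *: ((f \o shift (x + s *: v)) (h *: v) - f (x + s *: v))).
  apply/funext => h /=; congr (_ *: (f _ - _)).
  by rewrite [h *: 1]mulr1 scalerDl addrCA.
by split; rewrite /derivable /derive E.
Qed.

Lemma mvt_line f x v (h : R) : 0 < h ->
  (forall s : R, 0 <= s <= h -> derivable f (x + s *: v) v) ->
  exists2 c, 0 <= c <= h & f (x + h *: v) - f x = 'D_v f (x + c *: v) * h.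
Proof.
move=> h0 df.
have dl s : s \in `[0, h] -> is_derive s 1 (fun t => f (x + t *: v))
    ('D_v f (x + s *: v)).
  by rewrite in_itv/= => sh; apply: is_derive_line; exact: df.
have lcont : {within `[0, h], continuous (fun t => f (x + t *: v))}.
  by apply: derivable_within_continuous => s /dl [].
have [c ch] := MVT_segment (ltW h0) (fun s sh => dl s (subset_itv_oo_cc sh)) lcont.
by rewrite subr0 scale0r addr0 => E; exists c.
Qed.

Lemma derive_shift f x u v :
  'D_v (fun y => f (y + u)) x = 'D_v f (x + u).
Proof.
rewrite /derive; set F := (X in lim (X @ _) = _); set G := (X in _ = lim (X @ _)).
by suff -> : F = G by []; apply/funext => h; rewrite /F/G/= addrA.
Qed.

Lemma derivable_shift f x u v :
  derivable f (x + u) v -> derivable (fun y => f (y + u)) x v.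
Proof.
rewrite /derivable; set G := (X in cvg (X @ _)); set F := (X in _ -> cvg (X @ _)).
suff -> : G = F by [].
by apply/funext => h; rewrite /F/G/= addrA.
Qed.

(** The mean value theorem is applied twice: along [u] to the increment [F] of [f] in the direction
    [v], then along [v] to ['D_u f] at the intermediate point [x + s *: u]. *)
Lemma second_difference f x u v (h : R) : 0 < h ->
  (forall s t : R, 0 <= s <= h -> 0 <= t <= h ->
     derivable f (x + s *: u + t *: v) u /\
     derivable ('D_u f) (x + s *: u + t *: v) v) ->
  exists s t : R, [/\ 0 <= s <= h, 0 <= t <= h &
    f (x + h *: u + h *: v) - f (x + h *: u) - (f (x + h *: v) - f x) =
    'D_v ('D_u f) (x + s *: u + t *: v) * h * h].
Proof.
move=> h0 df.
have h00 : 0 <= (0 : R) <= h by rewrite lexx ltW.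
have hh : 0 <= h <= h by rewrite lexx ltW.
pose F := (fun y => f (y + h *: v)) - f.
have dF (s : R) : 0 <= s <= h -> derivable F (x + s *: u) u.
  move=> sh; apply: derivableB; first exact: derivable_shift (proj1 (df s h sh hh)).
  by have [+ _] := df s 0 sh h00; rewrite scale0r addr0.
have [s sh E] := mvt_line h0 dF.
have [t th E'] := mvt_line h0 (fun t th => proj2 (df s t sh th)).
exists s, t; split=> //; rewrite -E' -[LHS]/(F (x + h *: u) - F x) E.
congr (_ * h); rewrite deriveB ?derive_shift//.
- exact: derivable_shift (proj1 (df s h sh hh)).
- by have [+ _] := df s 0 sh h00; rewrite scale0r addr0.
Qed.

(** If the values differed, continuity with tolerance half their distance would keep [g1] and [g2]
    apart on a small ball around [x]. *)
Lemma continuous_eq_arbitrarily_close (g1 g2 : V -> R) x :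
  {for x, continuous g1} -> {for x, continuous g2} ->
  (forall r, 0 < r -> exists y z, [/\ ball x r y, ball x r z & g1 y = g2 z]) ->
  g1 x = g2 x.
Proof.
move=> c1 c2 close; apply/eqP; apply: contraT => neq.
have e0 : 0 < `|g1 x - g2 x| / 2 by rewrite divr_gt0// normr_gt0 subr_eq0.
move/cvgrPdist_lt : c1 => /(_ _ e0) near1.
move/cvgrPdist_lt : c2 => /(_ _ e0) near2.
have [r /= r0 near_x] := proj1 (nbhs_ballP x _) (filterI near1 near2).
have [y [z [/near_x[/= d1 _] /near_x[/= _ d2] E]]] := close r r0.
have := ltrD d1 d2; rewrite -splitr [`|g2 x - _|]distrC -E.
by move=> /(le_lt_trans (ler_distD (g1 y) _ _)); rewrite ltxx.
Qed.

(** The second difference over a small parallelogram is symmetric in [u] and [v]. Divided by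
    [h * h], it is a value of each mixed derivative at some point of the parallelogram, so the two
    continuous mixed derivatives share values arbitrarily close to [x]. *)
Lemma derive_comm f x u v :
  (\forall y \near x, [/\ derivable f y u, derivable f y v,
     derivable ('D_u f) y v & derivable ('D_v f) y u]) ->
  {for x, continuous ('D_v ('D_u f))} -> {for x, continuous ('D_u ('D_v f))} ->
  'D_v ('D_u f) x = 'D_u ('D_v f) x.
Proof.
move=> df cvu cuv; apply: (continuous_eq_arbitrarily_close cvu cuv) => r' r'0.
have [r0 /= r00 df_r0] := proj1 (nbhs_ballP x _) df.
pose r := Num.min r0 r'.
have r_gt0 : 0 < r by rewrite lt_min r00.
have C0 : 0 < `|u| + `|v| + 1 by rewrite ltr_wpDl// addr_ge0.
(* This keeps the parallelogram with sides [h *: u] and [h *: v] inside the ball of radius [r]; the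
   summand 1 makes the denominator positive even if [u] and [v] vanish. *)
pose h := r / (`|u| + `|v| + 1).
have h0 : 0 < h by rewrite divr_gt0.
have inb (s t : R) : 0 <= s <= h -> 0 <= t <= h -> ball x r (x + s *: u + t *: v).
  move=> /andP[s0 sh] /andP[t0 th]; rewrite -ball_normE /ball_/= -addrA.
  rewrite opprD addNKr normrN (le_lt_trans (ler_normD _ _))// !normrZ !ger0_norm//.
  rewrite (@le_lt_trans _ _ (h * (`|u| + `|v|)))//.
    by rewrite mulrDr lerD// ler_wpM2r.
  rewrite /h -mulrA gtr_pMr// mulrC ltr_pdivrMr// mul1r.
  by rewrite ltrDl.
have in0 y : ball x r y -> ball x r0 y by apply: le_ball; rewrite ge_min lexx.
have in' y : ball x r y -> ball x r' y by apply: le_ball; rewrite ge_min lexx orbT.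
have df_uv (s t : R) : 0 <= s <= h -> 0 <= t <= h ->
    derivable f (x + s *: u + t *: v) u /\
    derivable ('D_u f) (x + s *: u + t *: v) v.
  move=> sh th; have [du _ dvu _] := df_r0 _ (in0 _ (inb s t sh th)).
  exact: conj du dvu.
have df_vu (s t : R) : 0 <= s <= h -> 0 <= t <= h ->
    derivable f (x + s *: v + t *: u) v /\
    derivable ('D_v f) (x + s *: v + t *: u) u.
  move=> sh th; have [_ dv _ duv] := df_r0 _ (in0 _ (inb t s th sh)).
  rewrite addrAC; exact: conj dv duv.
have [s [t [sh th]]] := second_difference h0 df_uv.
have [s' [t' [sh' th']]] := second_difference h0 df_vu.
move: ('D_v ('D_u f)) ('D_u ('D_v f)) => g1 g2 E2 E1.
exists (x + s *: u + t *: v), (x + s' *: v + t' *: u); split.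
- exact: in' (inb s t sh th).
- by rewrite addrAC; exact: in' (inb t' s' th' sh').
(* After multiplication by [h * h], both sides are the same second difference up to the order of its
   terms. *)
- apply: (mulIf (lt0r_neq0 h0)); apply: (mulIf (lt0r_neq0 h0)).
  apply: etrans (esym E1) (etrans _ E2).
  have -> : x + h *: u + h *: v = x + h *: v + h *: u by exact: addrAC.
  move: (f _) (f _) (f _) (f _) => a b c d.
  by rewrite !opprB addrACA [in RHS]addrACA [- b + _]addrC.
Qed.

End Schwarz.

Lemma partial_eq_on {R : realType} {n : nat} (U : set 'rV[R]_n)
    (f g : 'rV[R]_n -> R) i x :
  open U -> (forall y, U y -> f y = g y) -> U x -> partial i f x = partial i g x.
Proof.
move=> oU fg Ux; apply: near_eq_derive; near=> y.
by apply: fg; near: y; exact: open_nbhs_nbhs.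
Unshelve. all: by end_near. Qed.

Lemma partial_comm {R : realType} {n : nat} (U : set 'rV[R]_n) f i j x :
  open U -> class_C U 2 f -> U x ->
  partial i (partial j f) x = partial j (partial i f) x.
Proof.
move=> oU [_ df] Ux.
apply: derive_comm.
- near=> y.
  have Uy : U y by near: y; exact: open_nbhs_nbhs.
  have [dfi [_ dfij]] := df i; have [dfj [_ dfji]] := df j.
  split; [exact: dfj|exact: dfi|exact: (dfji i).1|exact: (dfij j).1].
- by have [_ [_ /(_ i)[_ []]]] := df j => + _; exact.
- by have [_ [_ /(_ j)[_ []]]] := df i => + _; exact.
Unshelve. all: by end_near. Qed.

(** * Partial derivatives as commuting derivations of the algebra of smooth functions on U *)

Section PartialDerivatives.
Context {R : realType} {n : nat} (U : chart R n).
Implicit Types (f g : cinf U) (i j : 'I_n).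

Lemma cinf_class f k : class_C U k f.
Proof. by have /asboolP[] := cinfP f. Qed.

Lemma cinf_derivable f i x : chart_set U x -> derivable f x (delta_mx 0 i).
Proof. by have [_ /(_ i)[+ _]] := cinf_class f 1; exact. Qed.

Lemma pdE i f x : chart_set U x -> pd i f x = partial i f x.
Proof. by move=> Ux; rewrite /= patchE mem_set. Qed.

Lemma pd_is_additive i : zmod_morphism (@pd R n U i).
Proof.
move=> f g; apply: cinf_ext => x Ux.
rewrite pdE// [RHS](_ : _ = pd i f x - pd i g x)// !pdE//.
by rewrite /partial deriveB//; exact: cinf_derivable.
Qed.

HB.instance Definition _ i :=
  GRing.isZmodMorphism.Build (cinf U) (cinf U) (pd i) (pd_is_additive i).

Lemma pdZ i (c : R) f : pd i (c *: f) = c *: pd i f.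
Proof.
apply: cinf_ext => x Ux.
rewrite pdE// [RHS](_ : _ = c *: pd i f x)// !pdE//.
by rewrite /partial deriveZ//; exact: cinf_derivable.
Qed.

Lemma pdM i f g : pd i (f * g) = pd i f * g + f * pd i g.
Proof.
apply: cinf_ext => x Ux.
rewrite pdE// [RHS](_ : _ = pd i f x * g x + f x * pd i g x)// !pdE//.
rewrite /partial [LHS]deriveM; [|exact: cinf_derivable..].
by rewrite addrC [_ *: 'D__ f x]mulrC.
Qed.

Lemma pd1 i : pd i (1 : cinf U) = 0.
Proof. by apply: (addrI (pd i 1)); rewrite addr0 -{3}(mulr1 1) pdM mulr1 mul1r. Qed.

Lemma pdC i j f : pd i (pd j f) = pd j (pd i f).
Proof.
apply: cinf_ext => x Ux; have oU := @chart_open _ _ U.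
(* [pd l f] is cut off to 0 outside U, but U is open, so the outer derivative at [x] does not see
   the cut-off. *)
have pd_pd k l : pd k (pd l f) x = partial k (partial l f) x.
  exact: etrans (pdE k (pd l f) Ux) (partial_eq_on k oU (pdE l f) Ux).
exact: etrans (pd_pd i j)
  (etrans (partial_comm i j oU (cinf_class f 2) Ux) (esym (pd_pd j i))).
Qed.

End PartialDerivatives.

(** * The Moyal product *)

Section StarProduct.
Context {R : realType} {n : nat} {U : chart R n} (theta : 'M[R]_n).
Implicit Types (u v : cinf U) (a b c : fseries U) (i j k : 'I_n).
Local Notation "a ** b" := (star theta a b)
  (at level 40, left associativity).

Lemma bidiff_linearl q (c : R) u u' v :
  bidiff theta q (c *: u + u') v = c *: bidiff theta q u v + bidiff theta q u' v.
Proof.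
elim: q u u' v => [|q IHq] u u' v /=.
  apply: cinf_ext => x _; have := mulrDl (c * u x) (u' x) (v x).
  by rewrite -mulrA.
rewrite scaler_sumr -big_split; apply: eq_bigr => i _ /=.
rewrite scaler_sumr -big_split; apply: eq_bigr => j _ /=.
by rewrite raddfD /= pdZ IHq scalerDr !scalerA mulrC.
Qed.

Lemma bidiff_linearr q (c : R) u v v' :
  bidiff theta q u (c *: v + v') = c *: bidiff theta q u v + bidiff theta q u v'.
Proof.
elim: q u v v' => [|q IHq] u v v' /=.
  have := bidiff_linearl 0 c v v' u; rewrite /= [_ * u]mulrC [v * u]mulrC.
  by rewrite [v' * u]mulrC.
rewrite scaler_sumr -big_split; apply: eq_bigr => i _ /=.
rewrite scaler_sumr -big_split; apply: eq_bigr => j _ /=.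
by rewrite raddfD /= pdZ IHq scalerDr !scalerA mulrC.
Qed.

Lemma moyal_linearl q (c : R) u u' v :
  moyal theta q (c *: u + u') v = c *: moyal theta q u v + moyal theta q u' v.
Proof. by rewrite /moyal bidiff_linearl scalerDr !scalerA mulrC. Qed.

Lemma moyal_linearr q (c : R) u v v' :
  moyal theta q u (c *: v + v') = c *: moyal theta q u v + moyal theta q u v'.
Proof. by rewrite /moyal bidiff_linearr scalerDr !scalerA mulrC. Qed.

Lemma moyalZl q (c : R) u v : moyal theta q (c *: u) v = c *: moyal theta q u v.
Proof.
have M0 : moyal theta q 0 v = 0.
  by have := moyal_linearl q (-1) 0 0 v; rewrite scaler0 addr0 scaleN1r addNr.
by have := moyal_linearl q c u 0 v; rewrite M0 !addr0.
Qed.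

Lemma moyalZr q (c : R) u v : moyal theta q u (c *: v) = c *: moyal theta q u v.
Proof.
have M0 : moyal theta q u 0 = 0.
  by have := moyal_linearr q (-1) u 0 0; rewrite scaler0 addr0 scaleN1r addNr.
by have := moyal_linearr q c u v 0; rewrite M0 !addr0.
Qed.

(** Degree by degree, this is the differential equation of the exponential: the factor r+1 turns
    1/(r+1)! into 1/r!, and one copy of the bidifferential operator is split off. *)
Lemma moyalS r u v :
  r.+1%:R *: moyal theta r.+1 u v =
  \sum_i \sum_j theta i j *: moyal theta r (pd i u) (pd j v).
Proof.
rewrite /moyal scalerA factS natrM invfM mulrA divff ?pnatr_eq0// mul1r /=.
rewrite scaler_sumr; apply: eq_bigr => i _.
by rewrite scaler_sumr; apply: eq_bigr => j _; rewrite !scalerA mulrC.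
Qed.

Lemma fseriesD a b q : (a + b) q = a q + b q. Proof. by []. Qed.

Lemma fseriesN a q : (- a) q = - a q. Proof. by []. Qed.

Lemma fseriesZ (c : R) a q : (c *: a) q = c *: a q. Proof. by []. Qed.

Lemma fseries_sum (I : finType) (F : I -> fseries U) q :
  (\sum_i F i) q = \sum_i F i q.
Proof. exact: (big_morph (fun a => a q)). Qed.

Lemma star_linearl (r : R) a a' b : (r *: a + a') ** b = r *: (a ** b) + a' ** b.
Proof.
apply/funext => q; rewrite fseriesD fseriesZ scaler_sumr -big_split.
apply: eq_bigr => k _; rewrite scaler_sumr -big_split; apply: eq_bigr => l _.
exact: moyal_linearl.
Qed.

Lemma star_linearr (r : R) a b b' : a ** (r *: b + b') = r *: (a ** b) + a ** b'.
Proof.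
apply/funext => q; rewrite fseriesD fseriesZ scaler_sumr -big_split.
apply: eq_bigr => k _; rewrite scaler_sumr -big_split; apply: eq_bigr => l _.
exact: moyal_linearr.
Qed.

Lemma starDl a a' b : (a + a') ** b = a ** b + a' ** b.
Proof. by have := star_linearl 1 a a' b; rewrite !scale1r. Qed.

Lemma starDr a b b' : a ** (b + b') = a ** b + a ** b'.
Proof. by have := star_linearr 1 a b b'; rewrite !scale1r. Qed.

Lemma star0l b : 0 ** b = 0.
Proof. by apply: (addrI (0 ** b)); rewrite -starDl !addr0. Qed.

Lemma star0r a : a ** 0 = 0.
Proof. by apply: (addrI (a ** 0)); rewrite -starDr !addr0. Qed.

Lemma starZl (r : R) a b : (r *: a) ** b = r *: (a ** b).
Proof. by have := star_linearl r a 0 b; rewrite star0l !addr0. Qed.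

Lemma starZr (r : R) a b : a ** (r *: b) = r *: (a ** b).
Proof. by have := star_linearr r a b 0; rewrite star0r !addr0. Qed.

Lemma star_suml (I : finType) (F : I -> fseries U) b :
  (\sum_i F i) ** b = \sum_i F i ** b.
Proof.
exact: (big_morph (fun a => a ** b) (fun a a' => starDl a a' b) (star0l b)).
Qed.

Lemma star_sumr (I : finType) a (F : I -> fseries U) :
  a ** (\sum_i F i) = \sum_i a ** F i.
Proof. exact: (big_morph (star theta a) (starDr a) (star0r a)). Qed.

Lemma hpd_is_additive i : zmod_morphism (@hpd R n U i).
Proof. by move=> a b; apply/funext => q; rewrite /hpd raddfB. Qed.

HB.instance Definition _ i :=
  GRing.isZmodMorphism.Build (fseries U) (fseries U) (hpd i) (hpd_is_additive i).

Lemma hpdZ i (r : R) a : hpd i (r *: a) = r *: hpd i a.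
Proof. by apply/funext => q; exact: pdZ. Qed.

Lemma hpdC i j a : hpd i (hpd j a) = hpd j (hpd i a).
Proof. by apply/funext => q; exact: pdC. Qed.

Definition d_hbar a : fseries U := fun q => q.+1%:R *: a q.+1.

(** The induction step of the proofs below: to compare coefficients in degree q+1, differentiate in
    hbar and compare in degree q, which loses nothing since q+1 is invertible in R. *)
Lemma d_hbar_eqS a b q : d_hbar a q = d_hbar b q -> a q.+1 = b q.+1.
Proof. by apply: scalerI; rewrite pnatr_eq0. Qed.

Lemma d_hbarD a b : d_hbar (a + b) = d_hbar a + d_hbar b.
Proof. by apply/funext => q; exact: scalerDr. Qed.

Lemma hpd_d_hbar i a : hpd i (d_hbar a) = d_hbar (hpd i a).
Proof. by apply/funext => q; exact: pdZ. Qed.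

Lemma d_hbar_hconst u : d_hbar (hconst u) = 0.
Proof. by apply/funext => q; exact: scaler0. Qed.

Definition star_theta a b : fseries U :=
  \sum_i \sum_j theta i j *: (hpd i a ** hpd j b).

Lemma star_thetaE a b q :
  star_theta a b q = \sum_i \sum_j theta i j *: (hpd i a ** hpd j b) q.
Proof.
by rewrite /star_theta fseries_sum; apply: eq_bigr => i _; rewrite fseries_sum.
Qed.

(* From d/dhbar exp(hbar theta) = theta exp(hbar theta). This makes associativity,
   the Leibniz rule for hpd and the reversal under hbar |-> - hbar provable by
   induction on the degree in hbar, without expanding the exponential. *)
Lemma d_hbar_star a b :
  d_hbar (a ** b) = d_hbar a ** b + a ** d_hbar b + star_theta a b.
Proof.
apply/funext => q; rewrite !fseriesD star_thetaE.
pose M (k l : nat) := moyal theta (q.+1 - k - l) (a k) (b l).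
(* The factor q+1 is split as k + l + (q+1-k-l), the degrees contributed by [a], by [b] and by the
   exponential; each part yields one term of the product rule. *)
have -> : d_hbar (a ** b) q = \sum_(k < q.+2) \sum_(l < (q.+1 - k).+1)
    (k%:R *: M k l + l%:R *: M k l + (q.+1 - k - l)%:R *: M k l).
  rewrite /d_hbar scaler_sumr; apply: eq_bigr => -[k /= kq] _.
  rewrite scaler_sumr; apply: eq_bigr => -[l /= lq] _.
  by rewrite -!scalerDl -!natrD -/(M k l) -addnA subnKC// subnKC.
under eq_bigr do rewrite !big_split /=.
rewrite !big_split /=; congr (_ + _ + _).
(* In each of the three sums the weight kills the boundary terms, those with k = 0, l = 0 or k + l =
   q+1 respectively; what is left is a sum over degree q. *)
- rewrite big_ord_recl big1 ?add0r => [|l _]; last by rewrite scale0r.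
  apply: eq_bigr => k _; rewrite subSS; apply: eq_bigr => l _.
  by rewrite /M moyalZl// subSS.
- rewrite big_ord_recr/= subnn big_ord1 scale0r addr0.
  apply: eq_bigr => -[k /= kq] _; rewrite subSn//.
  rewrite big_ord_recl scale0r add0r; apply: eq_bigr => l _.
  by rewrite lift0 /M moyalZr subSn// subSS.
- rewrite big_ord_recr/= subnn big_ord1 scale0r addr0.
  under [RHS]eq_bigr do under eq_bigr do rewrite scaler_sumr.
  under [RHS]eq_bigr do rewrite exchange_big/=.
  rewrite exchange_big/=; apply: eq_bigr => -[k /= kq] _.
  rewrite subSn// big_ord_recr /= subnn scale0r addr0.
  under [RHS]eq_bigr do under eq_bigr do rewrite scaler_sumr.
  under [RHS]eq_bigr do rewrite exchange_big/=.
  rewrite exchange_big/=; apply: eq_bigr => -[l /= lq] _.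
  by rewrite /M !subSn// moyalS.
Qed.

Lemma star_coef0 a b : (a ** b) 0 = a 0 * b 0.
Proof.
rewrite /star !big_ord1.
by rewrite /moyal /= invr1 scale1r.
Qed.

(** Both sides are differentiated in hbar. The induction ranges over all [a] and [b], because its
    hypothesis is applied to their derivatives in hbar and in the coordinates; the theta terms agree
    since partial derivatives commute. *)
Lemma hpd_star k a b : hpd k (a ** b) = hpd k a ** b + a ** hpd k b.
Proof.
apply/funext => q; elim: q a b => [|q IHq] a b.
  by rewrite fseriesD !star_coef0 /hpd star_coef0 pdM.
apply: d_hbar_eqS; rewrite -hpd_d_hbar d_hbar_star d_hbarD !d_hbar_star.
rewrite !raddfD /= !fseriesD !IHq.
rewrite !fseriesD -!hpd_d_hbar.
have -> : hpd k (star_theta a b) q =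
    star_theta (hpd k a) b q + star_theta a (hpd k b) q.
  rewrite !star_thetaE /hpd star_thetaE raddf_sum -big_split.
  apply: eq_bigr => i _ /=.
  rewrite raddf_sum -big_split; apply: eq_bigr => j _ /=.
  have := IHq (hpd i a) (hpd j b); rewrite pdZ {1}/hpd => ->.
  by rewrite scalerDr (hpdC k i) (hpdC k j).
by rewrite [X in X + _ = _]addrACA; exact: addrACA.
Qed.

(** After differentiation in hbar, the Leibniz rule for [hpd] brings both bracketings to the same
    three theta terms, one for each pair among [a], [b], [c]. *)
Lemma starA a b c : a ** (b ** c) = (a ** b) ** c.
Proof.
apply/funext => q; elim: q a b c => [|q IHq] a b c.
  by rewrite !star_coef0 mulrA.
apply: d_hbar_eqS; rewrite !d_hbar_star starDr starDr !starDl !fseriesD !IHq.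
have -> : (a ** star_theta b c) q =
    \sum_i \sum_j theta i j *: (a ** hpd i b ** hpd j c) q.
  rewrite /star_theta star_sumr fseries_sum; apply: eq_bigr => i _.
  rewrite star_sumr fseries_sum; apply: eq_bigr => j _.
  by rewrite starZr fseriesZ IHq.
have -> : (star_theta a b ** c) q =
    \sum_i \sum_j theta i j *: (hpd i a ** hpd j b ** c) q.
  rewrite /star_theta star_suml fseries_sum; apply: eq_bigr => i _.
  rewrite star_suml fseries_sum; apply: eq_bigr => j _.
  by rewrite starZl fseriesZ.
have -> : star_theta a (b ** c) q =
    \sum_i \sum_j theta i j *: (hpd i a ** hpd j b ** c) q
    + \sum_i \sum_j theta i j *: (hpd i a ** b ** hpd j c) q.
  rewrite star_thetaE -big_split; apply: eq_bigr => i _ /=.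
  rewrite -big_split; apply: eq_bigr => j _ /=.
  by rewrite hpd_star starDr fseriesD !IHq scalerDr.
have -> : star_theta (a ** b) c q =
    \sum_i \sum_j theta i j *: (hpd i a ** b ** hpd j c) q
    + \sum_i \sum_j theta i j *: (a ** hpd i b ** hpd j c) q.
  rewrite star_thetaE -big_split; apply: eq_bigr => i _ /=.
  rewrite -big_split; apply: eq_bigr => j _ /=.
  by rewrite hpd_star starDl fseriesD scalerDr.
set S1 := \sum_i _; set S2 := \sum_i _; set S3 := \sum_i _.
rewrite -!addrA; congr (_ + (_ + _)).
by rewrite [RHS]addrCA; congr (_ + _); rewrite addrC addrA.
Qed.

Lemma hpd_hconst i u : hpd i (hconst u) = hconst (pd i u).
Proof. by apply/funext => -[|q] //; exact: raddf0. Qed.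

Lemma hconst0 : hconst 0 = 0 :> fseries U.
Proof. by apply/funext => -[]. Qed.

Lemma star1l a : hconst 1 ** a = a.
Proof.
apply/funext => q; elim: q a => [|q IHq] a; first by rewrite star_coef0 mul1r.
apply: d_hbar_eqS; rewrite d_hbar_star d_hbar_hconst star0l add0r.
rewrite fseriesD IHq star_thetaE.
rewrite big1 ?addr0// => i _; rewrite big1// => j _.
by rewrite hpd_hconst pd1 hconst0 star0l scaler0.
Qed.

Lemma star1r a : a ** hconst 1 = a.
Proof.
apply/funext => q; elim: q a => [|q IHq] a; first by rewrite star_coef0 mulr1.
apply: d_hbar_eqS; rewrite d_hbar_star d_hbar_hconst star0r addr0.
rewrite fseriesD IHq star_thetaE.
rewrite big1 ?addr0// => i _; rewrite big1// => j _.
by rewrite hpd_hconst pd1 hconst0 star0r scaler0.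
Qed.

(** * The involution hbar |-> - hbar and its reversal of star products *)

Definition hbar_opp a : fseries U := fun q => (-1) ^+ q *: a q.

Lemma hbar_opp_is_additive : zmod_morphism hbar_opp.
Proof. by move=> a b; apply/funext => q; exact: scalerBr. Qed.

HB.instance Definition _ :=
  GRing.isZmodMorphism.Build (fseries U) (fseries U) hbar_opp hbar_opp_is_additive.

Lemma hbar_oppZ (r : R) a : hbar_opp (r *: a) = r *: hbar_opp a.
Proof. by apply/funext => q; rewrite /hbar_opp !fseriesZ !scalerA mulrC. Qed.

Lemma hpd_hbar_opp i a : hpd i (hbar_opp a) = hbar_opp (hpd i a).
Proof. by apply/funext => q; exact: pdZ. Qed.

Lemma d_hbar_hbar_opp a : d_hbar (hbar_opp a) = - hbar_opp (d_hbar a).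
Proof.
apply/funext => q; rewrite /d_hbar /hbar_opp fseriesN !scalerA exprS.
by rewrite mulN1r mulrN scaleNr mulrC.
Qed.

Lemma hbar_opp_hconst u : hbar_opp (hconst u) = hconst u.
Proof. by apply/funext => -[|q]; rewrite /hbar_opp ?scale1r// scaler0. Qed.

Hypothesis theta_skew : theta^T = - theta.

(** Differentiation in hbar anticommutes with [hbar_opp]. In the theta term, this sign is absorbed
    by skewness of theta once the reversed factors have exchanged the summation indices. *)
Lemma hbar_oppM a b : hbar_opp (a ** b) = hbar_opp b ** hbar_opp a.
Proof.
apply/funext => q; elim: q a b => [|q IHq] a b.
  by rewrite /hbar_opp star_coef0 !scale1r mulrC star_coef0 !scale1r.
apply: d_hbar_eqS; rewrite d_hbar_hbar_opp !d_hbar_star !d_hbar_hbar_opp !raddfD /=.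
rewrite -[- hbar_opp (d_hbar b)]scaleN1r -[- hbar_opp (d_hbar a)]scaleN1r.
rewrite starZl starZr !scaleN1r !fseriesD !fseriesN !IHq -!addrA addrCA; congr (_ + (_ + _)).
rewrite /hbar_opp !star_thetaE scaler_sumr.
under eq_bigr do rewrite scaler_sumr.
rewrite exchange_big -sumrN; apply: eq_bigr => i _.
rewrite -sumrN; apply: eq_bigr => j _; rewrite !hpd_hbar_opp -IHq.
have -> : theta i j = - theta j i.
  by move/matrixP : theta_skew => /(_ j i); rewrite !mxE.
by rewrite /hbar_opp !scalerA mulNr scaleNr mulrC.
Qed.

End StarProduct.

(** * Bar duality of the Ricci curvatures *)

Section RicciDuality.
Context {A : pzRingType} {n : nat} (d : 'I_n -> {additive A -> A}).
Implicit Types (a b : A) (i j k l : 'I_n).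
Hypothesis dM : forall i a b, d i (a * b) = d i a * b + a * d i b.
Variable bar : {additive A -> A}.
Hypothesis bar1 : bar 1 = 1.
Hypothesis barM : forall a b, bar (a * b) = bar b * bar a.
Variables g ginv : 'I_n -> 'I_n -> A.
Hypothesis g_ginv : forall i j, \sum_k g i k * ginv k j = (i == j)%:R.
Hypothesis ginv_g : forall i j, \sum_k ginv i k * g k j = (i == j)%:R.
Hypothesis bar_g : forall i j, bar (g i j) = g j i.

(** Applying [bar] to the identity that [ginv] is a left inverse of [g] makes the transpose of [bar]
    of [ginv] a right inverse of [g]. A left and a right inverse of the same matrix coincide. *)
Lemma bar_ginv i j : bar (ginv i j) = ginv j i.
Proof.
pose M := \matrix_(i, j) g i j; pose N := \matrix_(i, j) ginv i j.
pose N' := \matrix_(i, j) bar (ginv j i).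
have MN' : M *m N' = 1%:M.
  apply/matrixP => k l; rewrite !mxE; transitivity (bar (\sum_s ginv l s * g s k)).
    by rewrite raddf_sum; apply: eq_bigr => s _; rewrite !mxE barM bar_g.
  by rewrite ginv_g eq_sym; case: (k == l); rewrite ?raddf0// bar1.
have NM : N *m M = 1%:M.
  apply/matrixP => k l; rewrite !mxE -ginv_g.
  by apply: eq_bigr => s _; rewrite !mxE.
have : N' = N by rewrite -[N']mul1mx -NM -mulmxA MN' mulmx1.
by move/matrixP/(_ j i); rewrite !mxE.
Qed.

Variables Gam Gamt Gup : 'I_n -> 'I_n -> 'I_n -> A.
Variable hess : 'I_n -> 'I_n -> 'I_n -> 'I_n -> A.
Hypothesis Gup_g : forall i j k, \sum_l Gup i j l * g l k = Gam i j k.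
Hypothesis d_g : forall i j k, d i (g j k) = Gam i j k + Gamt i k j.
Hypothesis d_Gam_anti : forall i j k l,
  d i (Gam j k l) - d j (Gam i k l) = hess j k i l - hess i k j l.
Hypothesis bar_Gam : forall i j k, bar (Gam i j k) = Gamt i j k.
Hypothesis bar_Gamt : forall i j k, bar (Gamt i j k) = Gam i j k.
Hypothesis bar_hess : forall i j k l, bar (hess i j k l) = hess k l i j.

(** The curvature with lowered index, written in connection coefficients over an arbitrary ring with
    derivations [d]; [curvatureE] brings the geometric curvature to this form. *)
Definition curv l k i j :=
  \sum_s ((d i (Gup j k s) + \sum_r Gup j k r * Gup i r s) -
          (d j (Gup i k s) + \sum_r Gup i k r * Gup j r s)) * g s l.

(** For an embedding, this is the pairing of d_i d_j X with d_k d_l X minus the contribution of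
    their tangential parts. *)
Let gauss i j k l :=
  hess i j k l - \sum_s \sum_r Gam i j r * ginv r s * Gamt k l s.

Lemma GupE i j s : Gup i j s = \sum_r Gam i j r * ginv r s.
Proof.
under eq_bigr do rewrite -Gup_g mulr_suml.
rewrite exchange_big /=; under eq_bigr => l _ do
  under eq_bigr do rewrite -mulrA.
under eq_bigr => l _ do rewrite -mulr_sumr g_ginv.
rewrite (bigD1 s)//= eqxx mulr1 big1 ?addr0// => l ls.
by rewrite (negbTE ls) mulr0.
Qed.

(** Differentiate [Gam j k l], the sum of the [Gup j k s * g s l], by the Leibniz rule. In the
    derivative of [g s l], the summand [Gam i s l] accounts for the quadratic term in [Gup], and the
    summand [Gamt i l s] gives the correction through [GupE]. *)
Lemma lower_second_covariant i j k l :
  \sum_s (d i (Gup j k s) + \sum_r Gup j k r * Gup i r s) * g s l =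
  d i (Gam j k l) - \sum_s \sum_r Gam j k r * ginv r s * Gamt i l s.
Proof.
rewrite -Gup_g raddf_sum.
under [X in X - _]eq_bigr do rewrite dM d_g mulrDr.
under [X in _ - X]eq_bigr do rewrite -mulr_suml -GupE.
rewrite -sumrB; under [RHS]eq_bigr do rewrite addrA addrK.
rewrite !big_split /=; under eq_bigr do rewrite mulrDl.
rewrite big_split /=; congr (_ + _).
under eq_bigr do rewrite mulr_suml.
rewrite exchange_big /=; apply: eq_bigr => s _.
by rewrite -Gup_g mulr_sumr; apply: eq_bigr => r _; rewrite mulrA.
Qed.

(* Gauss equation: the curvature comes from the second derivatives of the
   embedding, so it is the antisymmetrization of a bar-symmetric tensor. *)
Lemma curvE l k i j : curv l k i j = gauss j k i l - gauss i k j l.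
Proof.
rewrite /curv; under eq_bigr do rewrite mulrBl.
rewrite sumrB !lower_second_covariant /gauss.
by rewrite !opprD addrACA [RHS]addrACA d_Gam_anti.
Qed.

Lemma bar_gauss i j k l : bar (gauss i j k l) = gauss k l i j.
Proof.
rewrite raddfB /= bar_hess /gauss raddf_sum; congr (_ - _).
under eq_bigr do rewrite raddf_sum.
rewrite exchange_big; apply: eq_bigr => s _; apply: eq_bigr => r _ /=.
by rewrite !barM bar_Gam bar_Gamt bar_ginv mulrA.
Qed.

Lemma bar_curv l k i j : bar (curv l k i j) = curv k l j i.
Proof. by rewrite !curvE raddfB /= !bar_gauss. Qed.

Lemma bar_Ricci k j :
  bar (\sum_l \sum_i curv l k i j * ginv l i) =
  \sum_i \sum_l ginv i l * curv k l j i.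
Proof.
rewrite exchange_big raddf_sum; apply: eq_bigr => i _.
by rewrite raddf_sum; apply: eq_bigr => l _; rewrite barM bar_ginv bar_curv.
Qed.

Lemma bar_Ricci_up p j :
  bar (\sum_k \sum_l \sum_i ginv p k * curv l k i j * ginv l i) =
  \sum_i \sum_l \sum_k ginv i l * curv k l j i * ginv k p.
Proof.
under eq_bigr do rewrite exchange_big.
rewrite exchange_big raddf_sum; apply: eq_bigr => i _ /=.
rewrite exchange_big raddf_sum; apply: eq_bigr => l _ /=.
rewrite raddf_sum; apply: eq_bigr => k _.
by rewrite !barM !bar_ginv bar_curv mulrA.
Qed.

End RicciDuality.

(** An alias that carries [theta] in its type, so that the star product, which depends on [theta],
    can be declared as ring multiplication and the abstract duality applies. *)
Definition moyal_algebra {R : realType} {n : nat} {U : chart R n}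
  (theta : 'M[R]_n) : Type := fseries U.

Section MoyalAlgebra.
Context {R : realType} {n : nat} {U : chart R n} (theta : 'M[R]_n).

HB.instance Definition _ :=
  GRing.Lmodule.copy (@moyal_algebra R n U theta) (fseries U).
HB.instance Definition _ := GRing.Zmodule_isPzRing.Build
  (@moyal_algebra R n U theta) (@starA R n U theta) (@star1l R n U theta)
  (@star1r R n U theta) (@starDl R n U theta) (@starDr R n U theta).

End MoyalAlgebra.

(** * The canonical connection *)

Section Connection.
Context {R : realType} {n : nat} {U : chart R n} (theta : 'M[R]_n).
Local Notation A := (fseries U).
Local Notation "a ** b" := (star theta a b)
  (at level 40, left associativity).
Implicit Types (V W : ltan U) (i j k l : 'I_n).

Lemma kdelta1 i : kdelta U i i = hconst 1.
Proof. by rewrite /kdelta eqxx. Qed.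

Lemma kdelta0 i j : i != j -> kdelta U i j = 0.
Proof. by move=> /negbTE ij; rewrite /kdelta ij hconst0. Qed.

Lemma star_kdelta_suml (F : 'I_n -> A) j : \sum_i F i ** kdelta U i j = F j.
Proof.
rewrite (bigD1 j)//= kdelta1 star1r big1 ?addr0// => i ij.
by rewrite kdelta0// star0r.
Qed.

Lemma star_kdelta_sumr (F : 'I_n -> A) i : \sum_j F j ** kdelta U i j = F i.
Proof.
rewrite (bigD1 i)//= kdelta1 star1r big1 ?addr0// => j ij.
by rewrite kdelta0 1?eq_sym// star0r.
Qed.

Lemma sum_lact_lE (F : 'I_n -> A) :
  \sum_k lact theta (F k) (lE U k) = [ffun k => F k].
Proof.
apply/ffunP => k; rewrite sum_ffunE ffunE -[RHS]star_kdelta_suml.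
by apply: eq_bigr => i _; rewrite !ffunE.
Qed.

Lemma hlinearD (D : ltan U -> ltan U) : hlinear D -> {morph D : V W / V + W}.
Proof.
(* The unit of R[[hbar]]: linearity is given for a scaled sum, and this scalar specializes it to
   additivity. *)
move=> lin V W; pose one (q : nat) : R := (q == 0)%:R.
have tscale1 V' : tscale one V' = V'.
  apply/ffunP => k; rewrite ffunE; apply/funext => q.
  rewrite /hscale big_ord_recl subn0 scale1r big1 ?addr0// => r _.
  by rewrite scale0r.
by have := lin one V W; rewrite !tscale1.
Qed.

Lemma metric_form_rE (g : 'I_n -> 'I_n -> A) V l :
  metric_form theta g V (rE U l) = \sum_s V s ** g s l.
Proof.
apply: eq_bigr => s _; under eq_bigr do rewrite ffunE.
exact: star_kdelta_sumr.
Qed.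

Variables (nab : 'I_n -> ltan U -> ltan U) (G : 'I_n -> 'I_n -> 'I_n -> A).
Hypothesis nab_cov : left_covariant theta nab.
Hypothesis nab_lE : forall i j,
  nab i (lE U j) = \sum_k lact theta (G i j k) (lE U k).

(** Expanding [V] in the basis E_k, additivity and the left Leibniz rule reduce the covariant
    derivative to its values on the basis. *)
Lemma nabE i V t : nab i V t = hpd i (V t) + \sum_k V k ** G i k t.
Proof.
have [/hlinearD nabD nabL] := nab_cov i.
have nab0 : nab i 0 = 0 by apply: (addrI (nab i 0)); rewrite -nabD !addr0.
have {1}-> : V = \sum_k lact theta (V k) (lE U k).
  by rewrite sum_lact_lE; apply/ffunP => k; rewrite ffunE.
rewrite (big_morph _ nabD nab0); under eq_bigr do rewrite nabL.
rewrite big_split /= (sum_lact_lE (fun k => hpd i (V k))) !ffunE sum_ffunE.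
by congr (_ + _); apply: eq_bigr => k _; rewrite ffunE nab_lE sum_lact_lE ffunE.
Qed.

Lemma curvatureE (g : 'I_n -> 'I_n -> A) l k i j :
  curvature theta g nab l k i j =
  \sum_s ((hpd i (G j k s) + \sum_r G j k r ** G i r s) -
          (hpd j (G i k s) + \sum_r G i k r ** G j r s)) ** g s l.
Proof.
rewrite /curvature metric_form_rE; apply: eq_bigr => s _; congr (_ ** _).
have nab2 i' j' : nab i' (nab j' (lE U k)) s =
    hpd i' (G j' k s) + \sum_r G j' k r ** G i' r s.
  rewrite nab_lE sum_lact_lE nabE ffunE; congr (_ + _).
  by apply: eq_bigr => r _; rewrite ffunE.
by rewrite /curv_op !ffunE !nab2.
Qed.

End Connection.

(** * The metric and connection induced by X as an instance of the abstract duality *)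

Section EmbeddedMetric.
Context {R : realType} {n m : nat} {U : chart R n} (theta : 'M[R]_n).
Variables (p : nat) (X : 'I_m -> cinf U).
Local Notation "a ** b" := (star theta a b)
  (at level 40, left associativity).
Local Notation g := (nc_metric theta p X).
Implicit Types (i j k l : 'I_n).

(** The tensor H of the Gauss equation, in the role of [hess]; the tangential part has not been
    removed. *)
Definition second_form i j k l : fseries U :=
  \sum_al Defs.eta p al *:
    (hpd i (hpd j (hconst (X al))) ** hpd k (hpd l (hconst (X al)))).

Lemma hpd_nc_metric i j k :
  hpd i (g j k) = Gam theta p X i j k + Gamt theta p X i k j.
Proof.
rewrite raddf_sum -big_split; apply: eq_bigr => al _ /=.
by rewrite hpdZ hpd_star scalerDr.
Qed.

(** The terms with third derivatives of X are symmetric in [i] and [j], hence cancel and leave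
    products of second derivatives. *)
Lemma hpd_Gam_anti i j k l :
  hpd i (Gam theta p X j k l) - hpd j (Gam theta p X i k l) =
  second_form j k i l - second_form i k j l.
Proof.
rewrite /Gam /second_form !raddf_sum -!big_split; apply: eq_bigr => al _ /=.
rewrite !hpdZ !hpd_star !scalerDr (hpdC i j) opprD addrACA.
by rewrite subrr add0r.
Qed.

Hypothesis theta_skew : theta^T = - theta.

Lemma hbar_opp_hpd_hpd i j al : hbar_opp (hpd i (hpd j (hconst (X al)))) =
  hpd i (hpd j (hconst (X al))).
Proof. by rewrite -!hpd_hbar_opp hbar_opp_hconst. Qed.

Lemma hbar_opp_hpd i al : hbar_opp (hpd i (hconst (X al))) = hpd i (hconst (X al)).
Proof. by rewrite -hpd_hbar_opp hbar_opp_hconst. Qed.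

Lemma hbar_opp_nc_metric i j : hbar_opp (g i j) = g j i.
Proof.
rewrite raddf_sum; apply: eq_bigr => al _ /=.
by rewrite hbar_oppZ hbar_oppM// !hbar_opp_hpd.
Qed.

Lemma hbar_opp_Gam i j k : hbar_opp (Gam theta p X i j k) = Gamt theta p X i j k.
Proof.
rewrite raddf_sum; apply: eq_bigr => al _ /=.
by rewrite hbar_oppZ hbar_oppM// hbar_opp_hpd hbar_opp_hpd_hpd.
Qed.

Lemma hbar_opp_Gamt i j k : hbar_opp (Gamt theta p X i j k) = Gam theta p X i j k.
Proof.
rewrite raddf_sum; apply: eq_bigr => al _ /=.
by rewrite hbar_oppZ hbar_oppM// hbar_opp_hpd hbar_opp_hpd_hpd.
Qed.

Lemma hbar_opp_second_form i j k l :
  hbar_opp (second_form i j k l) = second_form k l i j.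
Proof.
rewrite raddf_sum; apply: eq_bigr => al _ /=.
by rewrite hbar_oppZ hbar_oppM// !hbar_opp_hpd_hpd.
Qed.

Variables (ginv : 'I_n -> 'I_n -> fseries U).
Hypothesis ginvP : inverse_metric theta g ginv.
Variables (nab : 'I_n -> ltan U -> ltan U) (nabt : 'I_n -> rtan U -> rtan U).
Hypothesis nabP : canonical_connection theta p X nab nabt.

Lemma kdeltaE i j : kdelta U i j = (i == j)%:R :> @moyal_algebra R n U theta.
Proof. by rewrite /kdelta; case: (i == j); rewrite ?hconst0. Qed.

Lemma g_ginv i j : \sum_k (g i k : moyal_algebra theta) * ginv k j = (i == j)%:R.
Proof. by rewrite -kdeltaE; exact: (ginvP i j).1. Qed.

Lemma ginv_g i j : \sum_k (ginv i k : moyal_algebra theta) * g k j = (i == j)%:R.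
Proof. by rewrite -kdeltaE /kdelta eq_sym; exact: (ginvP j i).2. Qed.

Definition star_pd i :
  {additive moyal_algebra theta -> moyal_algebra theta} := @hpd R n U i.

Definition star_bar :
  {additive moyal_algebra theta -> moyal_algebra theta} := @hbar_opp R n U.

Lemma curvature_curv : exists G : 'I_n -> 'I_n -> 'I_n -> fseries U,
  (forall i j k, \sum_l G i j l ** g l k = Gam theta p X i j k) /\
  forall l k i j, curvature theta g nab l k i j =
    curv star_pd (g : _ -> _ -> moyal_algebra theta) G l k i j.
Proof.
have [cov _ [G [GE Gg]] _] := nabP; exists G; split=> // l k i j.
exact: (curvatureE cov GE g).
Qed.

Lemma hbar_opp_Ricci k j :
  hbar_opp (Ricci theta g ginv nab k j) = Theta theta g ginv nab j k.
Proof.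
have [G [Gg curvE]] := curvature_curv.
have := bar_Ricci (d := star_pd) (bar := star_bar) (hpd_star theta)
  (hbar_opp_hconst 1) (hbar_oppM theta_skew) g_ginv ginv_g hbar_opp_nc_metric
  Gg hpd_nc_metric hpd_Gam_anti hbar_opp_Gam hbar_opp_Gamt
  hbar_opp_second_form k j.
(* The abstract curvature is folded back into [curvature] on both sides, which turns the sums into
   [Ricci] and [Theta]. *)
under eq_bigr do under eq_bigr do rewrite -curvE.
under [X in _ = X -> _]eq_bigr do under eq_bigr do rewrite -curvE.
exact.
Qed.

Lemma hbar_opp_Ricci_up i j :
  hbar_opp (Ricci_up theta g ginv nab i j) = Theta_up theta g ginv nab i j.
Proof.
have [G [Gg curvE]] := curvature_curv.
have := bar_Ricci_up (d := star_pd) (bar := star_bar) (hpd_star theta)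
  (hbar_opp_hconst 1) (hbar_oppM theta_skew) g_ginv ginv_g hbar_opp_nc_metric
  Gg hpd_nc_metric hpd_Gam_anti hbar_opp_Gam hbar_opp_Gamt
  hbar_opp_second_form i j.
under eq_bigr do under eq_bigr do under eq_bigr do rewrite -curvE.
under [X in _ = X -> _]eq_bigr do under eq_bigr do under eq_bigr do
  rewrite -curvE.
exact.
Qed.

End EmbeddedMetric.

(** The involution multiplies the coefficient of degree d by (-1)^d, so it fixes even coefficients
    and negates odd ones. *)
Lemma hbar_opp_parity {R : realType} {n : nat} {U : chart R n}
    (a b : fseries U) q : hbar_opp a = b ->
  a (2 * q)%N = b (2 * q)%N /\ a (2 * q).+1 = - b (2 * q).+1.
Proof.
by move=> <-; rewrite /hbar_opp exprS exprM sqrrN !expr1n mulr1 scale1r scaleN1r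
  opprK.
Qed.

Theorem corollary4p1 (R : realType) (n m p : nat) (hp : (p <= m)%N)
    (U : chart R n)
    (theta : 'M[R]_n) (theta_skew : theta^T = - theta)
    (g0 : 'I_n -> 'I_n -> cinf U) (hg0 : pseudo_riemannian g0)
    (X : 'I_m -> cinf U)
    (X_embedding : smooth_embedding X) (X_isometric : isometric p X g0)
    (ginv : 'I_n -> 'I_n -> fseries U)
    (hginv : inverse_metric theta (nc_metric theta p X) ginv)
    (nab : 'I_n -> ltan U -> ltan U) (nabt : 'I_n -> rtan U -> rtan U)
    (hnab : canonical_connection theta p X nab nabt) :
  let g := nc_metric theta p X in
  forall (q : nat) (i j : 'I_n),
    [/\ Ricci theta g ginv nab i j (2 * q)%N
          = Theta theta g ginv nab j i (2 * q)%N,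
        Ricci theta g ginv nab i j (2 * q).+1
          = - Theta theta g ginv nab j i (2 * q).+1,
        Ricci_up theta g ginv nab i j (2 * q)%N
          = Theta_up theta g ginv nab i j (2 * q)%N &
        Ricci_up theta g ginv nab i j (2 * q).+1
          = - Theta_up theta g ginv nab i j (2 * q).+1].
Proof.
move=> g q i j.
have [R0 R1] := hbar_opp_parity q (hbar_opp_Ricci theta_skew hginv hnab i j).
have [S0 S1] := hbar_opp_parity q (hbar_opp_Ricci_up theta_skew hginv hnab i j).
by split.
Qed.
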